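(* Let $0<\alpha<1$. There exist a dense $G_\delta$ set $\Lambda\subset[0,1)$ and a set $Y\subset X$ with $\mu_\alpha(Y)=1$ such that for every $\theta\in\Lambda$ and every $x\in Y$, $$\liminf_{n\to\infty}\frac1n\sum_{j=0}^{n-1}\left|e^{2\pi i\, d_j(x)\theta}-1\right|=0 .$$
   Context: The Pascal graph is the directed infinite graph with vertices $(n,k)$, $n=0,1,2,\dots$, $0\le k\le n$, with two edges leaving each vertex $(n,k)$: one to $(n+1,k)$, labelled $0$, and one to $(n+1,k+1)$, labelled $1$. $X$ is the space of infinite paths starting at the root $(0,0)$; reading edge labels identifies $X$ with $\Omega=\{0,1\}^{\mathbb N}$ (with its product $\sigma$-algebra). For $x\in X$, $k_n(x)$ is the number of $1$'s among the first $n$ labels of $x$, so the $n$-th vertex of $x$ is $(n,k_n(x))$, and $d_n(x)=\binom{n}{k_n(x)}$. For $0<\alpha<1$, $\mu_\alpha=\mathcal B(\alpha,1-\alpha)$ is the Bernoulli product measure on $X=\{0,1\}^{\mathbb N}$ for which the coordinates are independent, each equal to $0$ with probability $\alpha$ and to $1$ with probability $1-\alpha$. The interval $[0,1)$ carries its usual topology. *)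

(* Defs.v *)
From HB Require Import structures.
From mathcomp Require Import all_boot all_order all_algebra finmap.
From mathcomp Require Import complex.
From mathcomp Require Import all_classical all_reals all_analysis.
From mathcomp Require Import ring lra.
From mathcomp Require Import measurable_realfun borel_hierarchy.

Set Implicit Arguments.
Unset Strict Implicit.
Unset Printing Implicit Defensive.

Import Order.TTheory GRing.Theory Num.Theory.
Import numFieldTopology.Exports numFieldNormedType.Exports.

Local Open Scope classical_set_scope.
Local Open Scope ring_scope.

(* A path of the Pascal graph is its sequence of edge labels; [false] is the
   label 0 and [true] the label 1.  The n-th edge, counted from 0, leaves the
   vertex (n, k_n(x)). *)
Definition label (n : nat) (x : nat -> bool) : bool := x n.

Definition cylinders : set (set (nat -> bool)) :=
  \bigcup_n preimage_set_system setT (label n) measurable.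

Definition paths : Type := g_sigma_algebraType cylinders.

HB.instance Definition _ := Measurable.on paths.

Definition path_height (n : nat) (x : paths) : nat :=
  (\sum_(i < n) label i x)%N.

Definition path_dim (n : nat) (x : paths) : nat := 'C(n, path_height n x).

Definition mutually_independent d d' (T : measurableType d)
    (T' : measurableType d') (R : realType) (P : probability T R)
    (I : choiceType) (X : I -> T -> T') : Prop :=
  forall (J : {fset I}) (A : I -> set T'), (forall i, measurable (A i)) ->
    (P (\bigcap_(i in [set` J]) X i @^-1` A i) =
     \prod_(i <- J) P (X i @^-1` A i))%E.

Definition bernoulli_measure (R : realType) (alpha : R)
    (mu : probability paths R) : Prop :=
  mutually_independent mu label /\
  forall n, mu (label n @^-1` [set false]) = alpha%:E /\
            mu (label n @^-1` [set true]) = (1 - alpha)%:E.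

Definition expi (R : realType) (t : R) : R[i] := (cos t +i* sin t)%C.

(* [bernoulli_measure alpha] is inhabited: push Lebesgue measure on [0, 1[
   forward along the coding that splits an interval, at each step, in the
   proportions alpha (label 0) and 1 - alpha (label 1). *)
Section bernoulli_measure_exists.
Context (R : realType) (alpha : R) (halpha : 0 < alpha < 1).

Let a0 : 0 < alpha. Proof. by case/andP: halpha. Qed.
Let a1 : alpha < 1. Proof. by case/andP: halpha. Qed.

Let shift (x : R) : R := if x < alpha then x / alpha else (x - alpha) / (1 - alpha).
Let code (x : R) : paths := fun n => ~~ (iter n shift x < alpha).

Let pr (b : bool) : R := if b then 1 - alpha else alpha.
Let weight (w : seq bool) : R := \prod_(b <- w) pr b.
Let left_end (w : seq bool) : R :=
  foldr (fun b l => if b then alpha + (1 - alpha) * l else alpha * l) 0 w.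

Let left_end_cons b w : left_end (b :: w) =
  if b then alpha + (1 - alpha) * left_end w else alpha * left_end w.
Proof. by []. Qed.

Let pr_gt0 b : 0 < pr b.
Proof. by case: b; rewrite /pr ?subr_gt0. Qed.

Let weight_cons b w : weight (b :: w) = pr b * weight w.
Proof. by rewrite /weight big_cons. Qed.

Let weight_gt0 w : 0 < weight w.
Proof. by elim: w => [|b w IH]; rewrite ?weight_cons ?mulr_gt0// /weight big_nil. Qed.

Let ends_in w : 0 <= left_end w /\ left_end w + weight w <= 1.
Proof.
elim: w => [|b w [IH0 IH1]]; first by rewrite /weight big_nil add0r /=.
rewrite weight_cons left_end_cons /pr.
have h0 := a0; have h1 := a1.
have a1' : 0 < 1 - alpha by rewrite subr_gt0.
have p1 := mulr_ge0 (ltW a0) IH0.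
have p2 := mulr_ge0 (ltW a1') IH0.
have p3 : 0 <= alpha * (1 - (left_end w + weight w)).
  by rewrite mulr_ge0 ?subr_ge0// ltW.
have p4 : 0 <= (1 - alpha) * (1 - (left_end w + weight w)).
  by rewrite mulr_ge0 ?subr_ge0// ltW.
move: (left_end w) (weight w) p1 p2 p3 p4 IH0 IH1 => l v p1 p2 p3 p4 IH0 IH1.
by case: b; split; lra.
Qed.

Let shift_in x : 0 <= x < 1 -> 0 <= shift x < 1.
Proof.
case/andP=> x0 x1; rewrite /shift; case: ltP => xa.
  by rewrite divr_ge0 ?(ltW a0)//= ltr_pdivrMr ?mul1r.
by rewrite divr_ge0 ?subr_ge0 ?(ltW a1)//= ltr_pdivrMr ?subr_gt0// mul1r ltrD2r.
Qed.

Let code_word w x : 0 <= x < 1 ->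
  (mkseq (code x) (size w) == w) = (left_end w <= x < left_end w + weight w).
Proof.
elim: w x => [|b w IH] x x01; first by rewrite /weight big_nil add0r x01.
have -> : mkseq (code x) (size (b :: w)) = ~~ (x < alpha) :: mkseq (code (shift x)) (size w).
  rewrite /mkseq /= -[1%N]/(1 + 0)%N iotaDl -map_comp; congr (_ :: _).
  by apply: eq_map => n /=; rewrite /code -iterSr.
rewrite eqseq_cons IH ?shift_in// weight_cons left_end_cons /pr.
have [l0 l1] := ends_in w.
have w0 := weight_gt0 w.
have h0 := a0; have h1 := a1.
have a1' : 0 < 1 - alpha by rewrite subr_gt0.
have p2 := mulr_ge0 (ltW a1') l0.
have p3 : 0 <= alpha * (1 - (left_end w + weight w)).
  by rewrite mulr_ge0 ?subr_ge0// ltW.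
move: (left_end w) (weight w) l0 l1 w0 p2 p3 => l v l0 l1 w0 p2 p3.
rewrite /shift; case: (ltP x alpha) => xa; case: b => /=.
- apply/esym/negbTE; rewrite negb_and -ltNge; apply/orP; left; lra.
- by rewrite -mulrDr ler_pdivlMr// ltr_pdivrMr// ![_ * alpha]mulrC.
- rewrite -addrA -mulrDr ler_pdivlMr// ltr_pdivrMr//.
  by rewrite lerBrDl ltrBlDl ![_ * (1 - alpha)]mulrC.
- apply/esym/negbTE; rewrite negb_and -leNgt; apply/orP; right; lra.
Qed.

Let measurable_label n (A : set bool) : measurable (label n @^-1` A : set paths).
Proof.
apply: sub_gen_smallest; exists n => //=; exists A => //.
by rewrite setTI.
Qed.

Let measurable_code : measurable_fun setT code.
Proof.
have mshift : measurable_fun setT shift.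
  apply: measurable_fun_ifT => //.
  - exact: measurable_fun_ltr.
  - exact: mulrr_measurable.
  - by apply: measurable_funM => //; apply: measurable_funB.
have miter n : measurable_fun setT (iter n shift).
  elim: n => [|n IH]; first exact: measurable_id.
  by apply: measurableT_comp.
apply: (@measurability _ _ _ paths _ _ cylinders) => //.
move=> _ [_ [n _ [A mA <-]] <-].
rewrite setTI -[X in measurable X]setTI.
rewrite -comp_preimage.
have : measurable_fun setT (label n \o code).
  rewrite /comp /label /code.
  apply: measurable_neg.
  exact: measurable_fun_ltr.
by move=> /(_ measurableT _ mA); rewrite !setTI.
Qed.

Let I01 : set R := `[0, 1[%classic.
Let mI01 : measurable I01. Proof. exact: measurable_itv. Qed.

Let unif := mrestr lebesgue_measure mI01.
HB.instance Definition _ := Measure.on unif.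
Let unifT : unif setT = 1%E.
Proof. by rewrite /unif /mrestr setTI lebesgue_measure_itv /= lte_fin ltr01 oppr0 adde0. Qed.
HB.instance Definition _ := Measure_isProbability.Build _ _ _ unif unifT.
Let measurable_code' :
  measurable_fun setT (code : g_sigma_algebraType R.-ocitv.-measurable -> paths).
Proof. exact: measurable_code. Qed.
Let P : probability paths R := distribution unif 
  (@mfun_Sub _ _ (g_sigma_algebraType R.-ocitv.-measurable) paths code
    (mem_set measurable_code')).

Let cylinder w (A : nat -> set bool) m : set paths :=
  [set x | mkseq x (size w) = w /\ forall i, (i < m)%N -> A i (x (size w + i)%N)].

Let P_word w : P [set x | mkseq x (size w) = w] = (weight w)%:E.
Proof.
rewrite /P /distribution /pushforward /= /unif /mrestr.
rewrite (_ : _ `&` _ = `[left_end w, left_end w + weight w[%classic).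
  by rewrite lebesgue_measure_itv /= lte_fin ltrDl weight_gt0 -EFinB addrC addKr.
have [l0 l1] := ends_in w.
apply/seteqP; split => x /=; rewrite !in_itv /=.
  by move=> [/eqP xw x01]; rewrite -code_word.
move=> xw; have x01 : 0 <= x < 1.
  by move: (left_end w) (weight w) l0 l1 xw => l v l0 l1 xw; lra.
by split => //; apply/eqP; rewrite code_word.
Qed.

Let measurable_cylinder w A m : measurable (cylinder w A m).
Proof.
rewrite (_ : cylinder w A m =
    (\bigcap_(i in `I_(size w)) label i @^-1` [set nth false w i]) `&`
    (\bigcap_(i in `I_m) label (size w + i) @^-1` A i)).
  by apply: measurableI; apply: bigcap_measurableType => // i _; exact: measurable_label.
apply/seteqP; split => x /= [xw xA]; split => //.
  by move=> i /= im; rewrite -xw nth_mkseq.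
apply: (@eq_from_nth _ false); rewrite ?size_mkseq// => i im.
by rewrite nth_mkseq//; exact: xw.
Qed.

Let q (A : set bool) : R := `[< A false >]%:R * alpha + `[< A true >]%:R * (1 - alpha).

Let P_cylinder m w A :
  P (cylinder w A m) = (weight w * \prod_(i < m) q (A i))%:E.
Proof.
elim: m w A => [|m IH] w A.
  rewrite big_ord0 mulr1 -P_word; congr (P _).
  by apply/seteqP; split => x; [case|split].
pose C b := if `[< A 0%N b >] then cylinder (rcons w b) (A \o S) m else set0.
have mC b : measurable (C b) by rewrite /C; case: ifP.
have PC b : P (C b) = (`[< A 0%N b >]%:R * (weight w * pr b * \prod_(i < m) q (A i.+1)))%:E.
  rewrite /C; case: ifP => _; last by rewrite measure0 mul0r.
  by rewrite IH mul1r /weight -cats1 big_cat big_seq1.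
have mkS (x : paths) n : mkseq x n.+1 = rcons (mkseq x n) (x n).
  by rewrite /mkseq -addn1 iotaD map_cat /= cats1 add0n.
have -> : cylinder w A m.+1 = C false `|` C true.
  apply/seteqP; split => x.
    move=> [xw xA]; have := xA 0%N isT; rewrite addn0 => A0.
    have Cx : C (x (size w)) x.
      rewrite /C asboolT// /cylinder /= size_rcons mkS xw; split => // i im.
      by rewrite addSnnS; exact: xA.
    by move: Cx; case: (x _); [right|left].
  move=> CC; have [b Cx] : exists b, C b x by case: CC; [exists false|exists true].
  move: Cx; rewrite /C; case: asboolP => // A0 [].
  rewrite size_rcons mkS => /rcons_inj [xw xb] xA; split => // -[_|i im].
    by rewrite addn0 xb.
  by rewrite -addSnnS; exact: xA.
have C0 : C false `&` C true = set0.
  rewrite -subset0 => x []; rewrite /C; case: asboolP => // _; case: asboolP => // _.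
  by move=> [+ _] [+ _]; rewrite !size_rcons => -> /rcons_inj [].
have -> : P (C false `|` C true) = (P (C false) + P (C true))%E by exact: measureU.
rewrite !PC -EFinD big_ord_recl /=; congr EFin; rewrite /q /pr.
by ring.
Qed.

Let P_finite (J : {fset nat}) (A : nat -> set bool) :
  P (\bigcap_(i in [set` J]) label i @^-1` A i) = (\prod_(i <- J) q (A i))%:E.
Proof.
pose n := (\max_(i <- J) i).+1.
pose B i := if i \in J then A i else setT.
have Jn i : i \in J -> (i < n)%N by move=> iJ; rewrite ltnS (leq_bigmax_seq (F := id)).
rewrite (_ : \bigcap_(i in _) _ = cylinder [::] B n); last first.
  apply/seteqP; split => x /=.
    move=> xA; split => // i _; rewrite /B add0n; case: ifP => // iJ; exact: xA.
  move=> [_ xB] i /= iJ; have := xB i (Jn i iJ); by rewrite /B iJ.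
rewrite P_cylinder /weight big_nil mul1r; congr EFin.
rewrite -(big_mkord xpredT (fun i => q (B i))).
rewrite (eq_bigr (fun i => if i \in J then q (A i) else 1)); last first.
  move=> i _; rewrite /B; case: ifP => // _.
  by rewrite /q !asboolT// !mul1r addrC subrK.
rewrite -big_mkcond -big_filter; apply: perm_big; apply: uniq_perm.
- by rewrite filter_uniq// iota_uniq.
- exact: fset_uniq.
- move=> i; rewrite mem_filter mem_index_iota /=.
  by case iJ: (i \in J) => //=; rewrite Jn.
Qed.

Let P_label i (A : set bool) : P (label i @^-1` A) = (q A)%:E.
Proof.
have := P_finite [fset i]%fset (fun=> A).
by rewrite big_seq_fset1 set_fset1 bigcap_set1.
Qed.

Lemma bernoulli_measure_exists :
  exists mu : probability paths R, bernoulli_measure alpha mu.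
Proof.
exists P; split.
  move=> J A _; rewrite P_finite -prodEFin.
  by apply: eq_bigr => i _; rewrite P_label.
move=> n; rewrite !P_label /q; split; congr EFin.
  by rewrite asboolT// asboolF// mul1r mul0r addr0.
by rewrite asboolF// asboolT// mul1r mul0r add0r.
Qed.

End bernoulli_measure_exists.

(* Main.v *)
(* Work with the dyadic rationals r / 2^s.  If 2^s divides d_j(x), then
   e(d_j(x) theta) = e(d_j(x) (theta - r / 2^s)), which is close to 1 as soon as
   theta is much closer to r / 2^s than 2^-j.  So Lambda is taken to be the set
   of theta lying, for infinitely many s, within delta_s of some r / 2^s; it
   contains all dyadic rationals, hence is dense.

   It remains to see that along almost every path most d_j(x) are divisible by
   2^s.  By Kummer's theorem the 2-adic valuation of C(n, k) is at least the
   number of binary positions at which k has the digit 1 and n the digit 0; on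
   the b lowest digits this count only depends on (n, k) modulo 2^b.  As n runs
   over time, (n, k_n) equidistributes modulo 2^b (Doeblin's contraction
   argument), and for uniform digits the count has exponential moment
   (7/8)^b at base 1/2.  Hence the mean proportion of j < N with
   2^s not dividing d_j tends to 0; choosing N_s with mean proportion at most
   2^-s, the proportions are almost surely summable over s, so tend to 0. *)

Require Import Defs.
From mathcomp Require Import all_boot all_order all_algebra finmap.
From mathcomp Require Import complex.
From mathcomp Require Import all_classical all_reals all_analysis.
From mathcomp Require Import measurable_realfun borel_hierarchy.
From mathcomp Require Import zify ring lra.

Set Implicit Arguments.
Unset Strict Implicit.
Unset Printing Implicit Defensive.

Import Order.TTheory GRing.Theory Num.Theory.
Import numFieldTopology.Exports numFieldNormedType.Exports.

Local Open Scope classical_set_scope.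
Local Open Scope ring_scope.

(** * Powers of 2 dividing binomial coefficients *)

(** Among the borrows in [n - k] that Kummer's theorem counts, only those forced by the two digits
    at a position alone are kept. No borrow has to be propagated, so the count sees only the [b]
    lowest digits. *)
Fixpoint carries (b n k : nat) : nat :=
  if b is b'.+1 then (odd k && ~~ odd n + carries b' n./2 k./2)%N else 0%N.

(** One step of Legendre's formula: odd factors of [n!] contribute nothing, and the even ones are
    the doubles of [1, ..., n./2]. *)
Lemma logn2_fact_half n : logn 2 n`! = (n./2 + logn 2 (n./2)`!)%N.
Proof.
have fact_double m : logn 2 (m.*2)`! = (m + logn 2 m`!)%N.
  elim: m => [//|m IH]; rewrite doubleS !factS !lognM ?muln_gt0 ?fact_gt0// IH.
  have -> : logn 2 m.*2.+1 = 0%N by rewrite lognE dvdn2 /= odd_double.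
  rewrite -doubleS -muln2 lognM//= [logn 2 2](_ : _ = 1%N)//; lia.
rewrite -{1}(odd_double_half n); case: (odd n); rewrite ?add0n ?fact_double//.
rewrite add1n factS lognM ?fact_gt0// fact_double.
by rewrite [logn 2 _.*2.+1]lognE dvdn2 /= odd_double.
Qed.

Lemma logn2_bin n k : (k <= n)%N ->
  logn 2 n`! = (logn 2 'C(n, k) + (logn 2 k`! + logn 2 (n - k)`!))%N.
Proof.
by move=> kn; rewrite -(bin_fact kn) !lognM ?muln_gt0 ?fact_gt0 ?bin_gt0.
Qed.

(** Halving [n] and [k] removes the lowest digits. By Legendre the valuation then drops by
    [1 + logn 2 (n./2 - k./2)] if [k] is odd and [n] even, since [n - k] borrows there, and is
    unchanged otherwise. *)
Lemma carries_le_logn2_bin b n k : (k <= n)%N ->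
  (carries b n k <= logn 2 'C(n, k))%N.
Proof.
elim: b n k => [//|b IH] n k kn /=.
have kn2 : (k./2 <= n./2)%N by exact: half_leq.
have := IH _ _ kn2; have := logn2_bin kn; have := logn2_bin kn2.
rewrite (logn2_fact_half n) (logn2_fact_half k) (logn2_fact_half (n - k)).
have := odd_double_half n; have := odd_double_half k.
have [/andP[ok on]|nc] := boolP (odd k && ~~ odd n).
- rewrite ok (negbTE on) add0n add1n => ek en.
  have -> : (n - k)./2 = (n./2 - k./2).-1 by lia.
  have : (0 < n./2 - k./2)%N by lia.
  case nk: (n./2 - k./2)%N => [//|m] _ /=.
  rewrite add1n factS lognM ?fact_gt0//; lia.
- rewrite add0n => ek en.
  suff -> : (n - k)./2 = (n./2 - k./2)%N by lia.
  case: (odd n) en nc; case: (odd k) ek => //=;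
    rewrite ?add0n ?add1n => ek en _; lia.
Qed.

Lemma expn2_carries_dvd_bin b n k : (2 ^ carries b n k %| 'C(n, k))%N.
Proof.
have [kn|nk] := leqP k n; last by rewrite bin_small.
by rewrite pfactor_dvdn ?bin_gt0// carries_le_logn2_bin.
Qed.

Lemma carriesDl b n k q : carries b (q * 2 ^ b + n) k = carries b n k.
Proof.
elim: b n k q => [//|b IH] n k q /=.
have e : (q * 2 ^ b.+1 = (q * 2 ^ b).*2)%N by rewrite expnS; lia.
by rewrite e oddD odd_double /= halfD odd_double /= doubleK IH.
Qed.

Lemma carriesDr b n k : carries b n (k + 2 ^ b) = carries b n k.
Proof.
elim: b n k => [//|b IH] n k /=.
have e : (2 ^ b.+1 = (2 ^ b).*2)%N by rewrite expnS; lia.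
by rewrite e oddD odd_double addbF halfD odd_double andbF add0n doubleK IH.
Qed.

Lemma sum_ord_double (V : nmodType) (f : nat -> V) m :
  \sum_(n < m.*2) f n = \sum_(n < m) (f n.*2 + f n.*2.+1).
Proof.
elim: m => [|m IH]; first by rewrite !big_ord0.
by rewrite doubleS !big_ord_recr /= IH addrA.
Qed.

(** Of the four pairs of lowest digits, three have weight 1 and one has weight 1/2, so each digit
    contributes a factor 7/2. *)
Lemma sum_exp_carries (F : numFieldType) b :
  \sum_(n < 2 ^ b) \sum_(k < 2 ^ b) (2^-1 : F) ^+ carries b n k = (7 / 2) ^+ b.
Proof.
elim: b => [|b IH]; first by rewrite expr0 !big_ord1.
have e : (2 ^ b.+1 = (2 ^ b).*2)%N by rewrite expnS; lia.
rewrite e (sum_ord_double (fun n => \sum_(k < _) 2^-1 ^+ carries b.+1 n k)).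
rewrite exprS -IH mulr_sumr; apply: eq_bigr => n _.
rewrite !(sum_ord_double (fun k => 2^-1 ^+ carries b.+1 _ k)) -big_split /=.
rewrite mulr_sumr; apply: eq_bigr => k _ /=.
rewrite !odd_double /= !doubleK !uphalf_double !add0n.
by rewrite add1n exprS; field.
Qed.

(** * Equidistribution of the height modulo [M] *)

Section one_step_average.
Context (R : realFieldType) (alpha : R) (halpha : 0 < alpha < 1).

(** The Markov operator of the height: its [n]-th iterate at [k] is the mean of [g] at the height
    reached from [k] after [n] steps. *)
Definition step_average (g : nat -> R) (k : nat) : R :=
  alpha * g k + (1 - alpha) * g k.+1.

Let A := step_average.
Let a0 : 0 < alpha. Proof. by case/andP: halpha. Qed.
Let a1 : 0 < 1 - alpha. Proof. by rewrite subr_gt0; case/andP: halpha. Qed.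

Lemma le_iter_step_average n g h : (forall k, g k <= h k) ->
  forall k, iter n A g k <= iter n A h k.
Proof.
move=> gh; elim: n => [//|n IH] k /=.
by rewrite lerD// ler_pM2l.
Qed.

Lemma iter_step_average_ge0 n g : (forall k, 0 <= g k) ->
  forall k, 0 <= iter n A g k.
Proof.
move=> g0; elim: n => [//|n IH] k /=.
by rewrite addr_ge0// mulr_ge0// ltW.
Qed.

Lemma iter_step_average_affine n g a c k :
  iter n A (fun k => a * g k + c) k = a * iter n A g k + c.
Proof. by elim: n k => [//|n IH] k /=; rewrite /A/step_average !IH; ring. Qed.

Let d := Num.min alpha (1 - alpha).

(** Every word of [n] labels has probability at least [d ^+ n], and each of the heights
    [k, ..., k + n] is reached by some word. *)
Lemma window_le_iter_step_average n g : (forall k, 0 <= g k) ->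
  forall k, d ^+ n * \sum_(c < n.+1) g (k + c)%N <= iter n A g k.
Proof.
move=> g0; have d0 : 0 <= d by rewrite le_min !ltW.
elim: n => [|n IH] k; first by rewrite big_ord1 addn0 mul1r.
apply: le_trans (lerD (ler_wpM2l (ltW a0) (IH k)) (ler_wpM2l (ltW a1) (IH k.+1))).
rewrite exprS -mulrA.
set u := d ^+ n * _; set v := d ^+ n * _; set w := d ^+ n * _.
have dn0 : 0 <= d ^+ n by exact: exprn_ge0.
have v0 : 0 <= v by rewrite mulr_ge0// sumr_ge0.
have w0 : 0 <= w by rewrite mulr_ge0// sumr_ge0.
(* The window of [n + 2] heights at [k] is covered by the windows of [n + 1] heights at [k] and at
   [k + 1]. *)
have uvw : u <= v + w.
  rewrite -mulrDr ler_wpM2l// big_ord_recr /= lerD2l (bigD1 ord_max)//=.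
  by rewrite addSnnS lerDl sumr_ge0.
apply: (le_trans (ler_wpM2l d0 uvw)); rewrite mulrDr.
by rewrite lerD// ler_wpM2r// ge_min lexx ?orbT.
Qed.

Context (M : nat) (M_gt0 : (0 < M)%N).
Let periodic (g : nat -> R) := forall k, g (k + M)%N = g k.
Let total (g : nat -> R) := \sum_(c < M) g c.

Let periodic_iter n g : periodic g -> periodic (iter n A g).
Proof.
by move=> pg; elim: n => [//|n IH] k /=; rewrite /A /step_average -addSn !IH.
Qed.

Let total_window g k : periodic g -> \sum_(c < M) g (k + c)%N = total g.
Proof.
rewrite /periodic /total => pg; elim: k => [//|k <-].
case: M pg => [|m] pg; first by rewrite !big_ord0.
rewrite big_ord_recr [RHS]big_ord_recl /= addn0 addrC addSnnS pg; congr (_ + _).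
by apply: eq_bigr => i _; rewrite addSnnS.
Qed.

(** The uniform measure on residues modulo [M] is invariant under a step. *)
Let total_iter n g : periodic g -> total (iter n A g) = total g.
Proof.
move=> pg; elim: n => [//|n IH] /=.
rewrite /total/A/step_average big_split/= -!mulr_sumr.
have e : \sum_(c < M) iter n A g c.+1 = total (iter n A g).
  exact: (total_window 1%N (periodic_iter n pg)).
by rewrite e [X in alpha * X](_ : _ = total (iter n A g))//
  IH -mulrDl subrKC mul1r.
Qed.

(** The mass left after removing [d ^+ M] from each of the [M] residue classes. *)
Definition doeblin_rate := 1 - M%:R * d ^+ M.
Let rho := doeblin_rate.

Let total_le_iter g k : periodic g -> (forall k, 0 <= g k) ->
  d ^+ M * total g <= iter M A g k.
Proof.
move=> pg g0; apply: le_trans (window_le_iter_step_average M g0 k).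
have d0 : 0 <= d by rewrite le_min !ltW.
rewrite -(total_window k pg) ler_wpM2l ?exprn_ge0//.
(* [M] steps reach [M + 1] heights, one more than a full period; the extra term is dropped. *)
by rewrite big_ord_recr /= lerDl.
Qed.

Lemma doeblin_rate_itv : 0 <= doeblin_rate < 1.
Proof.
have d0 : 0 < d by rewrite lt_min a0.
rewrite /doeblin_rate subr_ge0 ltrBlDr ltrDl mulr_gt0 ?exprn_gt0 ?ltr0n// andbT.
(* Nonnegativity of the rate is the lower bound [total_le_iter] tested on the constant 1, which
   averaging fixes. *)
have -> : M%:R * d ^+ M = d ^+ M * total (fun=> 1).
  by rewrite /total sumr_const card_ord mulrC.
apply: (le_trans (@total_le_iter (fun=> 1) 0%N _ _)) => //.
rewrite (_ : (fun _ : nat => 1) = (fun k => 0 * (fun=> 0) k + 1)).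
  by rewrite iter_step_average_affine mul0r add0r.
by apply/funext => k; rewrite mul0r add0r.
Qed.

(* After [M] steps every residue class has received mass at least [d ^+ M], so
   the part of [g] that is not yet constant loses the factor [rho]. *)
Lemma iter_step_average_doeblin q r g k : periodic g -> (forall k, 0 <= g k) ->
  iter (q * M + r) A g k <= total g / M%:R + rho ^+ q * total g.
Proof.
move=> pg g0; rewrite iterD.
have := periodic_iter r pg; have := iter_step_average_ge0 r g0.
rewrite -(total_iter r pg); move: (iter r A g) => {}g {}g0 {}pg.
elim: q g g0 pg k => [|q IH] g g0 pg k.
  rewrite mul1r (le_trans (y := total g))//; last first.
    by rewrite lerDr divr_ge0// sumr_ge0.
  rewrite -(total_window k pg) (bigD1 (Ordinal M_gt0))//= addn0 lerDl.
  exact: sumr_ge0.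
rewrite mulSn addnC iterD; set S := total g.
pose h := fun k => iter M A g k - d ^+ M * S.
have -> : iter M A g = (fun k => 1 * h k + d ^+ M * S).
  by apply/funext => j; rewrite mul1r subrK.
rewrite iter_step_average_affine mul1r.
have h0 j : 0 <= h j by rewrite subr_ge0 total_le_iter.
have ph : periodic h by move=> j; rewrite /h periodic_iter.
have th : total h = rho * S.
  rewrite /total /h sumrB -/(total _) total_iter// -/S sumr_const card_ord.
  by rewrite /rho /doeblin_rate -mulr_natl; ring.
apply: (le_trans (lerD (IH h h0 ph k) (lexx _))).
have M0 : M%:R != 0 :> R by rewrite pnatr_eq0 -lt0n.
rewrite th exprSr -mulrA addrAC lerD2r /rho /doeblin_rate.
by rewrite le_eqVlt; apply/orP; left; apply/eqP; field.
Qed.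

End one_step_average.

(** * Mean proportion of times at which [2 ^ s] does not divide *)

Lemma sum_ord_mul (V : nmodType) (f : nat -> V) L M :
  \sum_(j < L * M) f j = \sum_(q < L) \sum_(r < M) f (q * M + r)%N.
Proof.
elim: L => [|L IH]; first by rewrite !big_ord0.
by rewrite big_ord_recr /= -IH mulSn addnC big_split_ord.
Qed.

Section cesaro_bound.
Context (R : realType) (alpha : R) (halpha : 0 < alpha < 1).
Let T := step_average alpha.

(** The probability that [2 ^ s] does not divide [d_j], stated without the measure; [mu_path_height]
    identifies the two. *)
Definition prob_not_dvd (s j : nat) : R :=
  iter j T (fun k => (~~ (2 ^ s %| 'C(j, k))%N)%:R) 0%N.

(** Markov's inequality: when [2 ^ s] fails to divide, [carries] is below [s], so [2 ^+ s] times the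
    weight is at least 1. *)
Lemma prob_not_dvd_le s b j :
  prob_not_dvd s j <= 2 ^+ s * iter j T (fun k => 2^-1 ^+ carries b j k) 0%N.
Proof.
rewrite -[leRHS]addr0 -iter_step_average_affine//.
apply: le_iter_step_average => // k; rewrite addr0.
have [cs|sc] := leqP s (carries b j k).
  rewrite (dvdn_trans (dvdn_exp2l 2 cs) (expn2_carries_dvd_bin b j k)) /=.
  by rewrite mulr_ge0// exprn_ge0// invr_ge0.
rewrite -(subnK (ltnW sc)) exprD -mulrA -exprMn divff// expr1n mulr1.
apply: (@le_trans _ _ 1); first by rewrite lern1 leq_b1.
by rewrite exprn_ege1// ler1n.
Qed.

Lemma sum_prob_not_dvd_le s b : exists C, forall L,
  \sum_(j < L * 2 ^ b) prob_not_dvd s j <=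
    2 ^+ s * (7 / 8) ^+ b * (L * 2 ^ b)%:R + C.
Proof.
pose M := (2 ^ b)%N; have M0 : (0 < M)%N by rewrite expn_gt0.
pose rho := doeblin_rate alpha M.
have /andP[rho0 rho1] : 0 <= rho < 1 by exact: doeblin_rate_itv.
(* The Doeblin errors sum to at most a geometric series of ratio [rho] times the total weight
   [(7 / 2) ^+ b]. *)
exists (2 ^+ s * ((7 / 2) ^+ b / (1 - rho))) => L.
pose W r : R := \sum_(k < M) 2^-1 ^+ carries b r k.
have pW q r :
    prob_not_dvd s (q * M + r) <= 2 ^+ s * (W r / M%:R + rho ^+ q * W r).
  apply: (le_trans (prob_not_dvd_le s b _)); rewrite ler_wpM2l ?exprn_ge0//.
  have -> : (fun k => 2^-1 ^+ carries b (q * M + r) k) =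
      (fun k => 2^-1 ^+ carries b r k :> R).
    by apply/funext => k; rewrite carriesDl.
  apply: iter_step_average_doeblin => // k; first by rewrite carriesDr.
rewrite sum_ord_mul -/M.
apply: (@le_trans _ _
    (\sum_(q < L) \sum_(r < M) (2 ^+ s * (W r / M%:R + rho ^+ q * W r)))).
  by apply: ler_sum => q _; apply: ler_sum => r _.
have WE : \sum_(r < M) W r = (7 / 2) ^+ b by exact: sum_exp_carries.
under eq_bigr => q _ do rewrite -mulr_sumr big_split/= -mulr_suml -mulr_sumr WE.
rewrite -mulr_sumr -mulrA -mulrDr ler_wpM2l ?exprn_ge0// big_split /=.
rewrite sumr_const card_ord lerD//.
  rewrite -[leLHS]mulr_natr natrM /M natrX.
  have -> : (7 / 2) ^+ b = (7 / 8) ^+ b * 2 ^+ b * 2 ^+ b :> R.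
    by rewrite -!exprMn; congr (_ ^+ _); field.
  by rewrite mulfK ?expf_neq0// mulrAC mulrA.
rewrite -mulr_suml mulrC ler_wpM2l ?exprn_ge0 ?divr_ge0//.
have := subrX1 rho L; rewrite -(opprB 1 rho) mulNr => geo.
rewrite -(ler_pM2l (_ : 0 < 1 - rho)) ?subr_gt0// divff ?subr_eq0 ?gt_eqF//.
by rewrite -[leLHS]opprK -geo opprB lerBlDr lerDl exprn_ge0.
Qed.

Lemma exists_cesaro_small s eps : 0 < eps ->
  exists2 N, (s < N)%N & \sum_(j < N) prob_not_dvd s j <= N%:R * eps.
Proof.
move=> eps0.
have [b bP] : exists b, 2 ^+ s * (7 / 8) ^+ b <= eps / 2.
  have h78 : `|7 / 8| < 1 :> R by rewrite ger0_norm; lra.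
  have e0 : 0 < eps / 2 / 2 ^+ s by rewrite !divr_gt0// exprn_gt0.
  have /cvgr0_norm_le /(_ _ e0) [b _ /(_ b (leqnn b))] := cvg_expr h78.
  rewrite ger0_norm ?exprn_ge0 ?divr_ge0// => hb; exists b.
  by rewrite mulrC -ler_pdivlMr ?exprn_gt0.
have [C CP] := sum_prob_not_dvd_le s b.
(* First [b] made the main term at most [eps / 2] per unit of time; now [L] is large enough to
   absorb [C] in the other half and to exceed [s]. *)
pose L := maxn s.+1 (Num.truncn (C / (eps / 2))).+1.
exists (L * 2 ^ b)%N.
  by apply: (leq_trans (leq_maxl _ _ : s < L)%N); rewrite leq_pmulr// expn_gt0.
apply: (le_trans (CP L)).
rewrite [eps in leRHS]splitr mulrDr lerD//.
  by rewrite mulrC ler_wpM2l.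
rewrite -ler_pdivrMr ?divr_gt0//.
apply: (le_trans (ltW (truncnS_gt _))).
rewrite ler_nat; apply: leq_trans (leq_maxr s.+1 _) _.
by rewrite leq_pmulr// expn_gt0.
Qed.
End cesaro_bound.

(** * Law of the height under the Bernoulli measure *)

Section height_law.
Context (R : realType) (alpha : R) (mu : probability paths R).
Hypothesis hmu : bernoulli_measure alpha mu.

Lemma measurable_label n (A : set bool) :
  measurable (label n @^-1` A : set paths).
Proof.
by apply: sub_gen_smallest; exists n => //=; exists A => //; rewrite setTI.
Qed.

Lemma path_heightS n (x : paths) :
  path_height n.+1 x = (path_height n x + label n x)%N.
Proof. by rewrite /path_height big_ord_recr. Qed.

Lemma measurable_path_height n (A : pred nat) :
  measurable [set x : paths | A (path_height n x)].
Proof.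
elim: n A => [|n IH] A.
  rewrite (_ : mkset _ = if A 0%N then setT else set0).
    by case: ifP => _; [exact: measurableT | exact: measurable0].
  by apply/seteqP; split => x; rewrite /path_height /= big_ord0; case: (A 0%N).
rewrite (_ : mkset _ =
  (label n @^-1` [set false] `&` [set x : paths | A (path_height n x)]) `|`
  (label n @^-1` [set true] `&` [set x : paths | A (path_height n x).+1])).
  apply: measurableU; apply: measurableI;
    [exact: measurable_label | exact: IH | exact: measurable_label
    | exact: (IH (fun k => A k.+1))].
apply/seteqP; split => x /=; rewrite path_heightS.
  by case: (label n x); rewrite ?addn1 ?addn0; [right | left].
by case=> -[->]; rewrite ?addn1 ?addn0.
Qed.

Let word_cylinder (w : seq bool) : set paths := [set x | mkseq x (size w) = w].
Let weight (w : seq bool) : R := \prod_(b <- w) (if b then 1 - alpha else alpha).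

Let word_cylinderE w : word_cylinder w =
  \bigcap_(i in [set` [fset i | i in iota 0 (size w)]%fset])
    label i @^-1` [set nth false w i].
Proof.
apply/seteqP; split => x.
  move=> xw i; rewrite /= in_fset /= mem_iota add0n => /= iw.
  by rewrite -xw nth_mkseq.
move=> xw; apply: (@eq_from_nth _ false); rewrite ?size_mkseq// => i iw.
by rewrite nth_mkseq//; apply: xw; rewrite /= in_fset /= mem_iota.
Qed.

Let measurable_word_cylinder w : measurable (word_cylinder w).
Proof.
rewrite word_cylinderE; apply: bigcap_measurableType => // i _.
exact: measurable_label.
Qed.

Let mu_word_cylinder w : mu (word_cylinder w) = (weight w)%:E.
Proof.
rewrite word_cylinderE (hmu.1 _ (fun i => [set nth false w i]))//.
pose p b := if b then 1 - alpha else alpha.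
rewrite (eq_bigr (fun i => (p (nth false w i))%:E)); last first.
  by move=> i _; have [h0 h1] := hmu.2 i; case: (nth false w i).
rewrite prodEFin; congr EFin.
rewrite /weight (big_nth false) /index_iota subn0; apply: perm_big.
by apply: uniq_perm => [||i]; rewrite ?fset_uniq ?iota_uniq// in_fset.
Qed.

Let word_cylinder_rcons w b (x : paths) :
  word_cylinder (rcons w b) x <-> word_cylinder w x /\ label (size w) x = b.
Proof.
rewrite /word_cylinder /= size_rcons /mkseq -addn1 iotaD map_cat /= cats1 add0n.
by split=> [/rcons_inj[]|[-> <-]].
Qed.

Let weight_rcons w b :
  weight (rcons w b) = (if b then 1 - alpha else alpha) * weight w.
Proof. by rewrite /weight -cats1 big_cat big_seq1 mulrC. Qed.

Let path_height_word w (x : paths) :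
  word_cylinder w x -> path_height (size w) x = count id w.
Proof.
elim/last_ind: w => [|w b IH]; first by rewrite /path_height big_ord0.
move=> /word_cylinder_rcons[/IH xw xb].
by rewrite size_rcons path_heightS xw xb -cats1 count_cat /= addn0.
Qed.

(** Fixing a prefix [w] makes the induction on [n] work: splitting on the next label lengthens the
    prefix and produces one [step_average]. *)
Let mu_word_cylinder_height w n (A : pred nat) :
  mu (word_cylinder w `&` [set x | A (path_height (size w + n) x)]) =
  (weight w * iter n (step_average alpha) (fun k => (A k)%:R) (count id w))%:E.
Proof.
elim: n w => [|n IH] w.
  rewrite addn0 /=.
  have [Aw|Aw] := boolP (A (count id w)).
    rewrite mulr1 -mu_word_cylinder; congr (mu _).
    apply/seteqP; split => x; first by case.
    by move=> xw; split => //=; rewrite path_height_word.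
  rewrite mulr0 -[RHS](measure0 mu); congr (mu _); apply/seteqP; split => x //.
  by move=> [xw] /=; rewrite path_height_word// (negbTE Aw).
pose E b := word_cylinder (rcons w b) `&`
  [set x | A (path_height (size (rcons w b) + n) x)].
have mE b : measurable (E b).
  by apply: measurableI => //; exact: measurable_path_height.
have -> : word_cylinder w `&` [set x | A (path_height (size w + n.+1) x)] =
    E false `|` E true.
  apply/seteqP; split => x.
    move=> [xw xA]; have xE : E (label (size w) x) x.
      by split; [exact/word_cylinder_rcons|rewrite /= size_rcons addSnnS].
    by case: (label _ x) xE => xE; [right|left].
  by case=> -[/word_cylinder_rcons[xw _]]; rewrite /= size_rcons addSnnS.
have E0 : E false `&` E true = set0.
  rewrite -subset0 => x [[/word_cylinder_rcons[_ xf] _]].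
  by move=> [/word_cylinder_rcons[_]]; rewrite xf.
have -> : mu (E false `|` E true) = (mu (E false) + mu (E true))%E.
  exact: measureU.
rewrite /E !IH !weight_rcons -EFinD; congr EFin.
rewrite -!cats1 !count_cat /= !addn0 addn1 /step_average; ring.
Qed.

Lemma mu_path_height n (A : pred nat) :
  mu [set x | A (path_height n x)] =
  (iter n (step_average alpha) (fun k => (A k)%:R) 0%N)%:E.
Proof.
have := mu_word_cylinder_height [::] n A.
rewrite /weight big_nil mul1r => <-; congr (mu _).
by apply/seteqP; split => x // [].
Qed.

End height_law.

(** * Size of [d_j] and distance of [expi] from 1 *)

Lemma bin_le_expn2 n k : ('C(n, k) <= 2 ^ n)%N.
Proof.
elim: n k => [[]//|n IH] [|k]; first by rewrite bin0 expn_gt0.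
by rewrite binS expnS mul2n -addnn leq_add.
Qed.

Section expi_bounds.
Context {R : realType}.
Implicit Types t u : R.

Lemma normr_sin_le u : `|sin u| <= `|u|.
Proof.
wlog u0 : u / 0 <= u => [H|].
  have [/H//|/ltW u0] := leP 0 u.
  by rewrite -normrN -sinN -(normrN u) H// oppr_ge0.
have [c _] : exists2 c, c \in `[0, u] & sin u - sin 0 = cos c * (u - 0).
  apply: MVT_segment => //.
  by apply: continuous_subspaceT => x; exact: continuous_sin.
rewrite sin0 !subr0 => ->; rewrite normrM -[leRHS]mul1r.
by rewrite ler_wpM2r// cos_max.
Qed.

Lemma normc_expiB1 t :
  ComplexField.Normc.normc (expi t - 1) = 2 * `|sin (t / 2)|.
Proof.
rewrite /expi /= subr0.
have -> : (cos t - 1) ^+ 2 + sin t ^+ 2 = (2 * sin (t / 2)) ^+ 2.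
  rewrite [in LHS](splitr t) cosD sinD.
  have := cos2Dsin2 (t / 2); move: (cos _) (sin _) => c s cs.
  have cc : c * c = 1 - s * s by rewrite -cs !expr2 addrK.
  have -> : (s * c + c * s) ^+ 2 = 4 * s * s * (c * c) by ring.
  by rewrite cc; ring.
by rewrite sqrtr_sqr normrM ger0_norm.
Qed.

Lemma normc_expiB1_le2 t : ComplexField.Normc.normc (expi t - 1) <= 2.
Proof. by rewrite normc_expiB1 -[leRHS]mulr1 ler_wpM2l// sin_max. Qed.

Lemma normc_expiB1_le t : ComplexField.Normc.normc (expi t - 1) <= `|t|.
Proof.
rewrite normc_expiB1 (le_trans (ler_wpM2l _ (normr_sin_le _)))//.
by rewrite normrM (@ger0_norm _ 2^-1) ?invr_ge0// mulrCA divff// mulr1.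
Qed.

Lemma expiD2pin t n : expi (t + 2 * pi * n%:R) = expi t.
Proof.
rewrite -mulrA mulr_natl mulr_natr mulrnAC /expi.
by rewrite (periodicn (@cosD2pi R)) (periodicn (@sinD2pi R)).
Qed.

Lemma normc_expi_dyadic s r d t : (2 ^ s %| d)%N ->
  ComplexField.Normc.normc (expi (2 * pi * d%:R * t) - 1) <=
  2 * pi * d%:R * `|t - r%:R / 2 ^+ s|.
Proof.
move=> /dvdnP[e de].
(* With [d = e * 2 ^ s], the product of [d] and [r / 2 ^ s] is the integer [e * r], that is, whole
   turns. *)
have -> : 2 * pi * d%:R * t =
    2 * pi * d%:R * (t - r%:R / 2 ^+ s) + 2 * pi * (e * r)%:R.
  rewrite de !natrM natrX; field; by rewrite expf_neq0.
rewrite expiD2pin (le_trans (normc_expiB1_le _))// normrM ger0_norm//.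
by rewrite !mulr_ge0// pi_ge0.
Qed.

End expi_bounds.

(** * Vanishing lower limits and almost sure convergence *)

Lemma limn_einf_eq0 (R : realType) (u : nat -> R) : (forall n, 0 <= u n) ->
  (forall n e, 0 < e -> exists2 m, (n <= m)%N & u m <= e) ->
  limn_einf (fun n => (u n)%:E) = 0%E.
Proof.
move=> u0 ue; rewrite limn_einf_lim.
suff -> : einfs (fun n => (u n)%:E) = cst 0%E by rewrite lim_cst.
apply/funext => n; rewrite /einfs /=; apply/eqP; rewrite eq_le; apply/andP; split.
  apply/lee_addgt0Pr => e e0; rewrite add0e.
  have [m nm um] := ue n e e0.
  apply: (@le_trans _ _ (u m)%:E); last by rewrite lee_fin.
  by apply: ereal_inf_lbound; exists m.
by apply: le_ereal_inf_tmp => _ [m _ <-]; rewrite lee_fin.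
Qed.

(** The expected sum of the [f n] is at most a convergent geometric series, so the sum is almost
    surely finite and its terms tend to 0. *)
Lemma summable_ae_cvg0 d (T : measurableType d) (R : realType)
    (P : probability T R) (f : nat -> T -> R) :
  (forall n x, 0 <= f n x) -> (forall n, measurable_fun setT (f n)) ->
  (forall n, (\int[P]_x (f n x)%:E <= (1 / (2 ^ n)%:R)%:E)%E) ->
  exists Y : set T, [/\ measurable Y, P Y = 1%E &
    forall x, Y x -> f n x @[n --> \oo] --> 0].
Proof.
move=> f0 mf intf.
pose F x := (\sum_(0 <= n <oo) (f n x)%:E)%E.
have F0 x : (0 <= F x)%E by apply: nneseries_ge0 => n _ _; rewrite lee_fin.
have mF : measurable_fun setT F.
  apply: (@ge0_emeasurable_sum _ _ _ setT (fun n x => (f n x)%:E) xpredT)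
    => [n x _ _|n _].
    by rewrite lee_fin.
  exact/measurable_EFinP.
have intF : (\int[P]_x F x < +oo)%E.
  rewrite integral_nneseries//; last 2 first.
  - by move=> n; exact/measurable_EFinP.
  - by move=> n x _; rewrite lee_fin.
  apply: (@le_lt_trans _ _ (\sum_(0 <= n <oo) (2 / (2 ^ (n + 1))%:R)%:E)%E).
    apply: lee_nneseries => [n _ _|n _].
      by apply: integral_ge0 => x _; rewrite lee_fin.
    apply: (le_trans (intf n)); rewrite lee_fin addn1 expnS natrM invfM mulrA.
    by rewrite divff.
  have /cvg_lim -> // := @cvg_geometric_eseries_half R 2 0.
  by rewrite ltry.
have iF : P.-integrable setT F.
  apply/integrableP; split => //.
  by under eq_integral => x _ do rewrite gee0_abs//.
pose Y := [set x | F x \is a fin_num].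
have mY : measurable Y.
  by rewrite -[Y]setTI; exact: emeasurable_fin_num.
exists Y; split => //.
- have [B [mB PB0 FB]] := integrable_ae measurableT iF.
  have PY0 : P (~` Y) = 0%E.
    apply/eqP; rewrite eq_le measure_ge0 andbT -PB0.
    apply: le_measure; rewrite ?inE//; first exact: measurableC.
    by move=> x Yx; apply: FB => /= /(_ I).
  rewrite -[Y]setCK probability_setC ?PY0 ?sube0//; exact: measurableC.
- move=> x Yx; have Foo : (F x < +oo)%E by rewrite ltey_eq Yx.
  have fx0 k : xpredT k -> (0 <= (f k x)%:E)%E by rewrite lee_fin.
  have tail := nneseries_tail_cvg Foo fx0.
  suff /fine_cvgP[_] : (f n x)%:E @[n --> \oo] --> 0%E by [].
  apply: (squeeze_cvge _ (cvg_cst _) tail); near=> n.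
  rewrite lee_fin f0 /=.
  apply: le_trans (nneseries_lim_ge n.+1 _) => [|k _ _]; last exact: fx0.
  by rewrite big_nat1.
Unshelve. all: by end_near. Qed.

(** * Frequency of non-divisibility along a path *)

Section divisibility_frequency.
Context (R : realType) (alpha : R) (halpha : 0 < alpha < 1)
  (mu : probability paths R) (hmu : bernoulli_measure alpha mu).

Definition not_dvd (s j : nat) : set paths :=
  [set x | ~~ (2 ^ s %| path_dim j x)%N].

Definition not_dvd_freq (s N : nat) (x : paths) : R :=
  N%:R^-1 * \sum_(j < N) \1_(not_dvd s j) x.

Let measurable_not_dvd s j : measurable (not_dvd s j).
Proof. exact: (measurable_path_height j (fun k => ~~ (2 ^ s %| 'C(j, k))%N)). Qed.

Lemma not_dvd_freq_ge0 s N x : 0 <= not_dvd_freq s N x.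
Proof. by rewrite mulr_ge0 ?invr_ge0// sumr_ge0. Qed.

Lemma measurable_not_dvd_freq s N : measurable_fun setT (not_dvd_freq s N).
Proof.
apply: measurable_funM => //; apply: measurable_sum => j.
exact: measurable_indic.
Qed.

Lemma exists_small_mean_not_dvd_freq s : exists2 N, (s < N)%N &
  (\int[mu]_x (not_dvd_freq s N x)%:E <= (1 / (2 ^ s)%:R)%:E)%E.
Proof.
have e0 : 0 < 1 / (2 ^ s)%:R :> R by rewrite divr_gt0// ltr0n expn_gt0.
have [N sN NP] := exists_cesaro_small halpha s e0.
exists N => //.
under eq_integral => x _ do rewrite /not_dvd_freq EFinM -sumEFin.
rewrite ge0_integralZl_EFin//; last 2 first.
- by move=> x _; rewrite sume_ge0// => i _; rewrite lee_fin.
- by apply: emeasurable_sum => j; apply/measurable_EFinP; exact: measurable_indic.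
rewrite ge0_integral_sum//; last first.
  by move=> j; apply/measurable_EFinP; exact: measurable_indic.
rewrite (eq_bigr (fun j : 'I_N => (prob_not_dvd alpha s j)%:E)); last first.
  move=> j _; rewrite integral_indic// setIT.
  exact: (mu_path_height hmu j (fun k => ~~ (2 ^ s %| 'C(j, k))%N)).
rewrite sumEFin -EFinM lee_fin ler_pdivrMl//.
by rewrite ltr0n (leq_ltn_trans _ sN).
Qed.

(** A time [j < N] with [2 ^ s] dividing [d_j] costs at most the first term, as [d_j <= 2 ^ N]; any
    other time costs at most 2. *)
Lemma mean_normc_expiB1_le s N r theta x : (0 < N)%N ->
  N%:R^-1 * \sum_(0 <= j < N)
    ComplexField.Normc.normc (expi (2 * pi * (path_dim j x)%:R * theta) - 1) <=
  2 * pi * 2 ^+ N * `|theta - r%:R / 2 ^+ s| + 2 * not_dvd_freq s N x.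
Proof.
move=> N0; rewrite ler_pdivrMl ?ltr0n// (mulrDr N%:R).
rewrite [_ * (2 * not_dvd_freq _ _ _)]mulrCA.
rewrite /not_dvd_freq mulVKf ?pnatr_eq0 -?lt0n// big_mkord mulr_sumr.
set c := 2 * pi * 2 ^+ N * _.
have c0 : 0 <= c by rewrite !mulr_ge0// ?pi_ge0 ?exprn_ge0.
have -> : N%:R * c = \sum_(j < N) c by rewrite sumr_const card_ord mulr_natl.
rewrite -big_split /=; apply: ler_sum => j _; rewrite indicE.
have [sd|sd] := boolP (2 ^ s %| path_dim j x)%N; last first.
  by rewrite mem_set// mulr1 ler_wpDl// normc_expiB1_le2.
rewrite memNset /not_dvd/= ?sd// mulr0 addr0.
apply: (le_trans (normc_expi_dyadic r theta sd)).
rewrite ler_wpM2r// ler_wpM2l ?mulr_ge0 ?pi_ge0//.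
rewrite -natrX ler_nat (leq_trans (bin_le_expn2 _ _))//.
by rewrite leq_exp2l// ltnW.
Qed.

End divisibility_frequency.

(** * The dense set of angles and the lower limit *)

Theorem theorem4p1 (R : realType) (alpha : R) (halpha : 0 < alpha < 1)
    (mu : probability paths R) (hmu : bernoulli_measure alpha mu) :
  exists (Lambda : set (set_type (`[0, 1[%classic : set R))) (Y : set paths),
    [/\ Gdelta Lambda, dense Lambda, measurable Y, mu Y = 1%E &
      forall theta x, Lambda theta -> Y x ->
        limn_einf (fun n => (n%:R^-1 * \sum_(0 <= j < n)
          ComplexField.Normc.normc
            (expi (2 * pi * (path_dim j x)%:R * set_val theta) - 1))%:E) = 0%E].
Proof.
have /choice [Nw NwP] : forall s, exists N, (s < N)%N /\
    (\int[mu]_x (not_dvd_freq R s N x)%:E <= (1 / (2 ^ s)%:R)%:E)%E.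
  by move=> s; have [N] := exists_small_mean_not_dvd_freq halpha hmu s; exists N.
have [||Y [mY muY Y0]] := summable_ae_cvg0
    (f := fun s => not_dvd_freq R s (Nw s)) _ _
    (fun s => (NwP s).2).
- by move=> s x; exact: not_dvd_freq_ge0.
- by move=> s; exact: measurable_not_dvd_freq.
(* Chosen so that [2 * pi * 2 ^+ Nw s * delta s] equals [1 / (s + 1)]. *)
pose delta s : R := (2 * pi * 2 ^+ Nw s * s.+1%:R)^-1.
have delta0 s : 0 < delta s.
  by rewrite invr_gt0 !mulr_gt0// ?pi_gt0 ?exprn_gt0.
pose G (m : nat) : set (set_type (`[0, 1[%classic : set R)) :=
  \bigcup_(s in [set s | (m <= s)%N]) \bigcup_r
    (set_val @^-1` ball (r%:R / 2 ^+ s : R) (delta s)).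
exists (\bigcap_m G m), Y; split => //.
- exists G => // m; apply: bigcup_open => s _; apply: bigcup_open => r _.
  apply: open_comp => [t _|]; last exact: ball_open.
  exact: initial_continuous.
- move=> O [t Ot] [B oB BO].
  have /nbhs_ballP[e /= e0 eB] : nbhs (set_val t) B.
    by apply: open_nbhs_nbhs; split => //; move: Ot; rewrite -BO.
  have [t0 t1] : 0 <= set_val t /\ set_val t < 1.
    by have := set_valP t; rewrite /= in_itv /= => /andP.
  (* The dyadic number is obtained by rounding down, so that it stays in [[0, 1)]; [s] makes the
     rounding error smaller than [e]. *)
  pose s := (Num.truncn e^-1).+1; pose r := Num.truncn (set_val t * 2 ^+ s).
  have p0 : 0 < 2 ^+ s :> R by rewrite exprn_gt0.
  have es : (2 ^+ s)^-1 < e.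
    rewrite invf_plt// (lt_trans (truncnS_gt _))// -natrX ltr_nat.
    exact: ltn_expl.
  have /andP[rt tr] : r%:R / 2 ^+ s <= set_val t < r%:R / 2 ^+ s + (2 ^+ s)^-1.
    rewrite ler_pdivrMr// -[X in _ + X]mul1r -mulrDl ltr_pdivlMr// natr1.
    by rewrite truncn_itv// mulr_ge0// ltW.
  have y01 : r%:R / 2 ^+ s \in (`[0, 1[%classic : set R).
    by rewrite inE /= in_itv /= divr_ge0 ?(ltW p0)// (le_lt_trans rt).
  exists (SigSub y01 : set_type (`[0, 1[%classic : set R)); split.
    rewrite -BO; apply: eB; rewrite /ball /= ger0_norm ?subr_ge0//.
    by rewrite ltrBlDl (lt_trans tr)// ltrD2l.
  (* Since [r / 2 ^ s] is also [r * 2 ^ m / 2 ^ (s + m)], a dyadic number is a centre at arbitrarily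
     fine levels, hence lies in every [G m]. *)
  move=> m _; exists (s + m)%N; first by rewrite /= leq_addl.
  exists (r * 2 ^ m)%N => //; rewrite /ball /=.
  rewrite natrM natrX exprD -mulf_div divff ?expf_neq0// mulr1.
  by rewrite subrr normr0.
- move=> theta x Gx Yx; apply: limn_einf_eq0 => [n|n e e0].
    rewrite mulr_ge0 ?invr_ge0// sumr_ge0// => j _.
    by rewrite normc_expiB1 mulr_ge0.
  have e4 : 0 < e / 4 by rewrite divr_gt0.
  have /cvgr0_norm_le /(_ _ e4) [S _ SP] := Y0 x Yx.
  (* For [s >= m]: [Nw s > s >= n], the frequency is at most [e / 4], and [1 / (s + 1)] is at most
     [e / 2]. *)
  pose m := maxn n (maxn S (Num.truncn (2 / e))).
  have [s /= ms [r _ /= tr]] := Gx m I.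
  have [nm Sm em] : [/\ (n <= s)%N, (S <= s)%N & (Num.truncn (2 / e) <= s)%N].
    by move: ms; rewrite !geq_max => /and3P.
  have [sN _] := NwP s.
  exists (Nw s); first exact: leq_trans nm (ltnW sN).
  apply: (le_trans (mean_normc_expiB1_le s r _ _ (leq_ltn_trans (leq0n s) sN))).
  rewrite [leRHS]splitr lerD//.
    have c0 : 0 < 2 * pi * 2 ^+ Nw s :> R.
      by rewrite !mulr_gt0// ?pi_gt0 ?exprn_gt0.
    rewrite -ler_pdivlMl// distrC (le_trans (ltW tr))// /delta invfM.
    rewrite ler_wpM2l ?invr_ge0 ?(ltW c0)//.
    rewrite -[leRHS]invrK lef_pV2 ?posrE ?invr_gt0 ?divr_gt0// invf_div.
    by rewrite (le_trans (ltW (truncnS_gt _)))// ler_nat.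
  have := SP s Sm; rewrite ger0_norm ?not_dvd_freq_ge0// => sb.
  by move: (not_dvd_freq _ _ _ _) sb => z zb; lra.
Qed.
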